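(* Let $\bar M={}_fI\times_\sigma M$ be a doubly warped spacetime with metric $\bar g=-f^2dt^2\oplus\sigma^2g$. A vector field $\bar\zeta=h\partial_t+\zeta$ is a Killing vector field on $\bar M$ if and only if one of the following conditions holds: (1) $\bar\zeta$ is time-like and $\dot h=\dot\sigma=0$; (2) $\bar\zeta$ is space-like, where $\zeta$ is a Killing vector field on $M$ and $\zeta(f)=0$; (3) $\dot h=-\zeta(\ln f)$ and $\zeta$ is a conformal vector field on $M$ with conformal factor $\rho_2=-\dfrac{2h\dot\sigma}{\sigma}$.
   Context: $(M,g)$ is a Riemannian manifold, $I$ is an open connected interval with metric $-dt^2$, and $f:M\to(0,\infty)$, $\sigma:I\to(0,\infty)$ are smooth. The doubly warped spacetime ${}_fI\times_\sigma M$ is $I\times M$ with the metric $\bar g=-f^2dt^2\oplus\sigma^2g$. Here $h:I\to\mathbb R$ is a smooth function of $t$, $\zeta\in\mathfrak X(M)$ (functions and vector fields on the factors are identified with their pullbacks/lifts to $\bar M$), and a dot denotes $d/dt$. ''$\bar\zeta$ is time-like'' means $\bar\zeta=h\partial_t$ (i.e. $\zeta=0$), and ''$\bar\zeta$ is space-like'' means $\bar\zeta=\zeta$ (i.e. $h=0$). A vector field $\zeta$ on $(N,k)$ is conformal with factor $\rho$ if $\mathcal L_\zeta k=\rho k$, and Killing if $\mathcal L_\zeta k=0$. The identities in (3) are understood on $I\times M$, i.e. $\mathcal L_\zeta g=-\frac{2h(t)\dot\sigma(t)}{\sigma(t)}g$ for every $t\in I$. *)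

(* Defs.v *)
From HB Require Import structures.
From mathcomp Require Import all_boot all_order all_algebra.
From mathcomp Require Import all_classical all_reals all_analysis.
Set Implicit Arguments.
Unset Strict Implicit.
Unset Printing Implicit Defensive.
Import Order.TTheory GRing.Theory Num.Theory.
Import numFieldNormedType.Exports.
Local Open Scope classical_set_scope.
Local Open Scope ring_scope.

(* F is C^k on the (open) set U: its iterated directional derivatives of order
   at most k exist and are continuous on U. On the finite-dimensional spaces
   used below this is the usual notion. *)
Fixpoint Ck_on (R : realType) (V W : normedModType R) (k : nat)
    (U : set V) (F : V -> W) : Prop :=
  (forall x, U x -> {for x, continuous F}) /\
  (if k is k'.+1 then
    forall v, (forall x, U x -> derivable F x v) /\ Ck_on k' U ('D_v F)
  else True).

Definition smooth_on (R : realType) (V W : normedModType R)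
    (U : set V) (F : V -> W) : Prop := forall k, Ck_on k U F.

Section calculus.
Context {R : realType}.
Implicit Types V W : normedModType R.

Lemma open_near (T : topologicalType) (U : set T) x : open U -> U x -> \near x, U x.
Proof. by move=> oU Ux; exact: open_nbhs_nbhs. Qed.

Lemma Ck_cont k V W (U : set V) (F : V -> W) :
  Ck_on k U F -> forall x, U x -> {for x, continuous F}.
Proof. by case: k => [|k] []. Qed.

Lemma Ck_le k V W (U : set V) (F : V -> W) : Ck_on k.+1 U F -> Ck_on k U F.
Proof.
elim: k F => [|k IH] F [cF dF]; first by split.
split=> // v; have [dFv CF] := dF v; split=> //; exact: IH.
Qed.

Lemma Ck_ext k V W (U : set V) (F G : V -> W) : open U ->
  (forall x, U x -> F x = G x) -> Ck_on k U F -> Ck_on k U G.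
Proof.
move=> oU; elim: k F G => [|k IH] F G FG CF.
all: have nFG x : U x -> \near x, F x = G x
  by move=> Ux; apply: filterS (open_near oU Ux).
all: have cG x : U x -> {for x, continuous G}
  by move=> Ux; apply: (cvg_trans (near_eq_cvg (nFG _ Ux)));
     rewrite -(FG _ Ux); exact: Ck_cont CF _ Ux.
  by [].
split=> // v; have [dFv CFv] := CF.2 v; split=> [x Ux|].
  exact: near_eq_derivable (nFG _ Ux) (dFv _ Ux).
by apply: IH CFv => x Ux; exact/near_eq_derive/nFG.
Qed.

Lemma smooth_ext V W (U : set V) (F G : V -> W) : open U ->
  (forall x, U x -> F x = G x) -> smooth_on U F -> smooth_on U G.
Proof. by move=> oU FG sF k; exact: Ck_ext (sF k). Qed.

Lemma smooth_cst V W (U : set V) (w : W) : smooth_on U (fun=> w).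
Proof.
move=> k; elim: k w => [|k IH] w.
  by split=> // x _; exact: cst_continuous.
split=> [x _|v]; first exact: cst_continuous.
split=> [x _|]; first exact: derivable_cst.
rewrite (_ : 'D_v _ = fun=> 0); first exact: IH.
by apply/funext => x; rewrite derive_cst.
Qed.

Lemma is_derive_add V W (F G : V -> W) x v : derivable F x v ->
  derivable G x v -> is_derive x v (fun y => F y + G y) ('D_v F x + 'D_v G x).
Proof.
by move=> dF dG; split; [exact: derivableD | exact: deriveD].
Qed.

Lemma Ck_add k V W (U : set V) (F G : V -> W) : open U ->
  Ck_on k U F -> Ck_on k U G -> Ck_on k U (fun x => F x + G x).
Proof.
move=> oU; elim: k F G => [|k IH] F G CF CG.
all: have cFG x : U x -> {for x, continuous (fun x => F x + G x)}
  by move=> Ux; apply: continuousD; [exact: Ck_cont CF _ Ux|exact: Ck_cont CG _ Ux].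
  by [].
split=> // v; have [dFv CFv] := CF.2 v; have [dGv CGv] := CG.2 v.
have H x : U x -> is_derive x v (fun y => F y + G y) ('D_v F x + 'D_v G x).
  by move=> Ux; apply: is_derive_add; [exact: dFv|exact: dGv].
split=> [x /H[]//|]; apply: Ck_ext (IH _ _ CFv CGv) => // x /H[_ ->]//.
Qed.

Lemma is_derive_scale V W (a : V -> R) (F : V -> W) x v : derivable a x v ->
  derivable F x v ->
  is_derive x v (fun y => a y *: F y) (a x *: 'D_v F x + 'D_v a x *: F x).
Proof.
move=> da dF.
suff H : (fun h : R => h^-1 *: (((fun y => a y *: F y) \o shift x) (h *: v)
      - a x *: F x)) @ 0^' --> a x *: 'D_v F x + 'D_v a x *: F x.
  by split; [apply/cvg_ex; eexists; exact: H | exact: cvg_lim H].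
have -> : (fun h : R => h^-1 *: (((fun y => a y *: F y) \o shift x) (h *: v)
      - a x *: F x)) =
  (fun h : R => a (h *: v + x) *: (h^-1 *: ((F \o shift x) (h *: v) - F x)) +
     (h^-1 *: ((a \o shift x) (h *: v) - a x)) *: F x).
  apply/funext => h /=.
  rewrite [in RHS]scalerA [a _ * _]mulrC -[in RHS]scalerA.
  rewrite [(h^-1 *: (a _ - a x)) *: _](_ : _ = h^-1 *: ((a (h *: v + x) - a x) *: F x)).
    by rewrite -scalerDr; congr (_ *: _); rewrite scalerBr scalerBl addrA subrK.
  by rewrite scalerA.
apply: cvgD; last by apply: cvgZr_tmp; exact: da.
apply: cvgZ; last exact: dF.
suff : {for 0, continuous (fun h : R => a (h *: v + x))}.
  by move=> /continuous_withinNx; rewrite scale0r add0r.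
exact/differentiable_continuous/derivable1_diffP/(derivable1P _ _ _).1.
Qed.

Lemma Ck_scale k V W (U : set V) (a : V -> R) (F : V -> W) : open U ->
  Ck_on k U a -> Ck_on k U F -> Ck_on k U (fun x => a x *: F x).
Proof.
move=> oU; elim: k a F => [|k IH] a F Ca CF.
all: have cFG x : U x -> {for x, continuous (fun x => a x *: F x)}
  by move=> Ux; apply: continuousZ; [exact: Ck_cont Ca _ Ux|exact: Ck_cont CF _ Ux].
  by [].
split=> // v; have [dav Cav] := Ca.2 v; have [dFv CFv] := CF.2 v.
have H x : U x -> is_derive x v (fun y => a y *: F y)
    (a x *: 'D_v F x + 'D_v a x *: F x).
  by move=> Ux; apply: is_derive_scale; [exact: dav|exact: dFv].
split=> [x /H[]//|].
apply: (@Ck_ext _ _ _ _ (fun x => a x *: 'D_v F x + 'D_v a x *: F x)) => //.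
  by move=> x /H[_ ->].
by apply: Ck_add => //; apply: IH => //; exact: Ck_le.
Qed.

Lemma is_derive_precomp V V' W (L : V' -> V) (F : V -> W) x v :
  linear L -> derivable F (L x) (L v) ->
  is_derive x v (F \o L) ('D_(L v) F (L x)).
Proof.
move=> linL dF; have E : (fun h : R => h^-1 *: (((F \o L) \o shift x) (h *: v)
    - (F \o L) x)) = (fun h => h^-1 *: ((F \o shift (L x)) (h *: L v) - F (L x))).
  by apply/funext => h /=; rewrite linL.
by split; rewrite /derivable /derive E.
Qed.

Lemma is_derive_postcomp V W W' (L : W -> W') (F : V -> W) x v :
  linear L -> continuous L -> derivable F x v ->
  is_derive x v (L \o F) (L ('D_v F x)).
Proof.
move=> linL cL dF.
have L0 : L 0 = 0.
  by have := linL (-1) 0 0; rewrite scaler0 addr0 scaleN1r addNr.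
have LZ a u : L (a *: u) = a *: L u by rewrite -[a *: u]addr0 linL L0 addr0.
have LB u w : L (u - w) = L u - L w.
  by rewrite -[- w]scaleN1r addrC linL scaleN1r addrC.
suff H : (fun h : R => h^-1 *: (((L \o F) \o shift x) (h *: v)
      - (L \o F) x)) @ 0^' --> L ('D_v F x).
  by split; [apply/cvg_ex; eexists; exact: H | exact: cvg_lim H].
have -> : (fun h : R => h^-1 *: (((L \o F) \o shift x) (h *: v) - (L \o F) x)) =
    L \o (fun h : R => h^-1 *: ((F \o shift x) (h *: v) - F x)).
  by apply/funext => h /=; rewrite LZ LB.
by apply: continuous_cvg; [exact: cL|exact: dF].
Qed.

Lemma Ck_precomp k V V' W (L : V' -> V) (U : set V) (F : V -> W) :
  open U -> linear L -> continuous L -> Ck_on k U F -> Ck_on k (L @^-1` U) (F \o L).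
Proof.
move=> oU linL cL; have oLU : open (L @^-1` U) by apply: open_comp oU => y _; exact: cL.
elim: k F => [|k IH] F CF.
all: have cFL x : U (L x) -> {for x, continuous (F \o L)}
  by move=> Ux; apply: continuous_comp; [exact: cL|exact: Ck_cont CF _ Ux].
  by [].
split=> // v; have [dF CFv] := CF.2 (L v).
have H x : U (L x) -> is_derive x v (F \o L) ('D_(L v) F (L x)).
  by move=> Ux; apply: is_derive_precomp => //; exact: dF.
split=> [x /H[]//|].
by apply: Ck_ext (IH _ CFv) => // x /H[_ ->].
Qed.

Lemma Ck_postcomp k V W W' (L : W -> W') (U : set V) (F : V -> W) :
  open U -> linear L -> continuous L -> Ck_on k U F -> Ck_on k U (L \o F).
Proof.
move=> oU linL cL; elim: k F => [|k IH] F CF.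
all: have cFL x : U x -> {for x, continuous (L \o F)}
  by move=> Ux; apply: continuous_comp; [exact: Ck_cont CF _ Ux|exact: cL].
  by [].
split=> // v; have [dF CFv] := CF.2 v.
have H x : U x -> is_derive x v (L \o F) (L ('D_v F x)).
  by move=> Ux; apply: is_derive_postcomp => //; exact: dF.
split=> [x /H[]//|].
by apply: Ck_ext (IH _ CFv) => // x /H[_ ->].
Qed.

Lemma smooth_add V W (U : set V) (F G : V -> W) : open U ->
  smooth_on U F -> smooth_on U G -> smooth_on U (fun x => F x + G x).
Proof. by move=> oU sF sG k; exact: Ck_add. Qed.

Lemma smooth_scale V W (U : set V) (a : V -> R) (F : V -> W) : open U ->
  smooth_on U a -> smooth_on U F -> smooth_on U (fun x => a x *: F x).
Proof. by move=> oU sa sF k; exact: Ck_scale. Qed.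

Lemma smooth_precomp V V' W (L : V' -> V) (U : set V) (F : V -> W) :
  open U -> linear L -> continuous L -> smooth_on U F ->
  smooth_on (L @^-1` U) (F \o L).
Proof. by move=> oU lL cL sF k; exact: Ck_precomp. Qed.

Lemma smooth_postcomp V W W' (L : W -> W') (U : set V) (F : V -> W) :
  open U -> linear L -> continuous L -> smooth_on U F -> smooth_on U (L \o F).
Proof. by move=> oU lL cL sF k; exact: Ck_postcomp. Qed.

Lemma Ck_sub k V W (U U' : set V) (F : V -> W) : U' `<=` U ->
  Ck_on k U F -> Ck_on k U' F.
Proof.
move=> UU'; elim: k F => [|k IH] F [cF dF]; (split; first by move=> x /UU'/cF) => // v.
by have [d C] := dF v; split=> [x /UU'/d//|]; exact: IH.
Qed.

Lemma smooth_sub V W (U U' : set V) (F : V -> W) : U' `<=` U ->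
  smooth_on U F -> smooth_on U' F.
Proof. by move=> UU' sF k; exact: Ck_sub (sF k). Qed.

End calculus.

Section topology.

Lemma hausdorff_prod (X Y : topologicalType) :
  hausdorff_space X -> hausdorff_space Y -> hausdorff_space (X * Y)%type.
Proof.
move=> hX hY [x y] [x' y'] C; congr pair; [apply: hX|apply: hY] => A B nA nB.
  have [||[u v] [/= Au Bu]] := C (A `*` setT) (B `*` setT).
  - by exists (A, setT) => //=; split=> //; exact: filterT.
  - by exists (B, setT) => //=; split=> //; exact: filterT.
  - by exists u; case: Au; case: Bu.
have [||[u v] [/= Au Bu]] := C (setT `*` A) (setT `*` B).
- by exists (setT, A) => //=; split=> //; exact: filterT.
- by exists (setT, B) => //=; split=> //; exact: filterT.
- by exists v; case: Au; case: Bu.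
Qed.

Lemma hausdorff_set_type (X : topologicalType) (A : set X) :
  hausdorff_space X -> hausdorff_space (set_type A).
Proof.
move=> hX x y C; apply: val_inj; apply: hX => U V nU nV.
have [||z [Uz Vz]] := C (set_val @^-1` U) (set_val @^-1` V).
- exact: (@initial_continuous (set_type A) X set_val x).
- exact: (@initial_continuous (set_type A) X set_val y).
- by exists (set_val z).
Qed.

Lemma second_countable_prod (X Y : topologicalType) :
  @second_countable X -> @second_countable Y ->
  @second_countable (X * Y)%type.
Proof.
move=> [B cB [oB bB]] [C cC [oC bC]].
exists ((fun p : set X * set Y => p.1 `*` p.2) @` (B `*` C)).
  exact: sub_countable (card_image_le _ _) (countableX cB cC).
split=> [_ [[U V] /= [BU CV]] <-|[x y] A [[P Q] /= [nP nQ] PQA]].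
  rewrite openE => -[u v] [/= Uu Vv]; exists (U, V) => //=.
  by split; apply: open_nbhs_nbhs; split=> //; [exact: oB|exact: oC].
have [U [BU Ux] UP] := bB x P nP; have [V [CV Vy] VQ] := bC y Q nQ.
exists (U `*` V); first by split=> //; exists (U, V).
by move=> [u v] [/UP Pu /VQ Qv]; exact: PQA.
Qed.

Lemma second_countable_set_type (X : topologicalType) (A : set X) :
  @second_countable X -> @second_countable (set_type A).
Proof.
move=> [B cB [oB bB]].
exists ((fun U : set X => (set_val @^-1` U : set (set_type A))) @` B).
  exact: sub_countable (card_image_le _ _) cB.
split=> [_ [U /= BU] <-|x P [_ [[V oV <-] Vx] VP]].
  by exists U => //; exact: oB.
have [U [BU Ux] UV] := bB (set_val x) V (open_nbhs_nbhs (conj oV Vx)).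
by exists (set_val @^-1` U); [split=> //; exists U | move=> u /UV/VP].
Qed.

Lemma second_countable_real (R : realType) : @second_countable R.
Proof.
exists ((fun p : rat * rat => [set` `]ratr p.1 : R, ratr p.2[%R]) @` setT).
  exact: sub_countable (card_image_le _ _) (countableP _).
split=> [_ [[p q] _] <-|x A]; first exact: interval_open.
move=> /nbhs_ballP[_/posnumP[e] eA].
have /rat_in_itvoo[p /itvP px] : x - e%:num < x by rewrite ltrBlDr ltrDl.
have /rat_in_itvoo[q /itvP qx] : x < x + e%:num by rewrite ltrDl.
exists [set` `]ratr p : R, ratr q[%R].
  by split; [exists (p, q)|rewrite /= in_itv/= px qx].
move=> y; rewrite /= in_itv/= => /andP[py yq]; apply: eA.
rewrite /ball /= distrC ltr_distl (lt_trans _ py) ?px//=.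
by rewrite (lt_trans yq) ?qx.
Qed.

End topology.

(* A smooth n-manifold: a Hausdorff second countable space with a smooth
   atlas, indexed by [chart]. The total functions [cmap c] and [cinv c] are
   only meaningful on [cdom c] and [cimg c], where they are inverse
   homeomorphisms. *)
Record manifold (R : realType) (n : nat) := Manifold {
  mpoint :> topologicalType ;
  m_hausdorff : hausdorff_space mpoint ;
  m_second_countable : @second_countable mpoint ;
  chart : Type ;
  cdom : chart -> set mpoint ;
  cimg : chart -> set 'rV[R]_n ;
  cmap : chart -> mpoint -> 'rV[R]_n ;
  cinv : chart -> 'rV[R]_n -> mpoint ;
  cdom_open : forall c, open (cdom c) ;
  cimg_open : forall c, open (cimg c) ;
  cmap_img : forall c p, cdom c p -> cimg c (cmap c p) ;
  cinv_dom : forall c x, cimg c x -> cdom c (cinv c x) ;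
  cmapK : forall c p, cdom c p -> cinv c (cmap c p) = p ;
  cinvK : forall c x, cimg c x -> cmap c (cinv c x) = x ;
  cmap_continuous : forall c p, cdom c p -> {for p, continuous (cmap c)} ;
  cinv_continuous : forall c x, cimg c x -> {for x, continuous (cinv c)} ;
  chart_cover : forall p, exists c, cdom c p ;
  transition_smooth : forall c d,
    smooth_on [set x | cimg c x /\ cdom d (cinv c x)] (cmap d \o cinv c)
}.

Arguments cdom_open {R n m} c : rename.
Arguments cimg_open {R n m} c : rename.
Arguments cdom {R n} m c _ : rename.
Arguments cimg {R n} m c _ : rename.
Arguments cmap {R n} m c _ : rename.
Arguments cinv {R n} m c _ : rename.

Definition overlap (R : realType) (n : nat) (M : manifold R n)
    (c d : chart M) : set 'rV[R]_n :=
  [set x | cimg M c x /\ cdom M d (cinv M c x)].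

Definition transition (R : realType) (n : nat) (M : manifold R n)
    (c d : chart M) : 'rV[R]_n -> 'rV[R]_n := cmap M d \o cinv M c.

Record smooth_fun (R : realType) (n : nat) (M : manifold R n) := SmoothFun {
  sfun :> M -> R ;
  sfun_smooth : forall c, smooth_on (cimg M c) (sfun \o cinv M c)
}.

(* Vector fields are given by their components in every chart, which
   transform by the differential of the coordinate changes. *)
Record vector_field (R : realType) (n : nat) (M : manifold R n) :=
  VectorField {
  vcomp :> chart M -> 'rV[R]_n -> 'rV[R]_n ;
  vcomp_smooth : forall c, smooth_on (cimg M c) (vcomp c) ;
  vcomp_change : forall c d x, overlap c d x ->
    vcomp d (transition c d x) = 'D_(vcomp c x) (transition c d) x
}.

Definition bilin (R : realType) (n : nat) (A : 'M[R]_n) (u v : 'rV[R]_n) : R :=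
  (u *m A *m v^T) 0 0.

(* Likewise for covariant 2-tensor fields: in each chart, the matrix of
   coefficients of the bilinear form in the coordinate basis. *)
Record tensor2 (R : realType) (n : nat) (M : manifold R n) := Tensor2 {
  tcomp :> chart M -> 'rV[R]_n -> 'M[R]_n ;
  tcomp_smooth : forall c, smooth_on (cimg M c) (tcomp c) ;
  tcomp_change : forall c d x u v, overlap c d x ->
    bilin (tcomp c x) u v =
    bilin (tcomp d (transition c d x))
      ('D_u (transition c d) x) ('D_v (transition c d) x)
}.

Record riemannian_metric (R : realType) (n : nat) (M : manifold R n) :=
  RiemannianMetric {
  rtensor :> tensor2 M ;
  rmetric_sym : forall c x u v, cimg M c x ->
    bilin (rtensor c x) u v = bilin (rtensor c x) v u ;
  rmetric_gt0 : forall c x u, cimg M c x -> u != 0 ->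
    0 < bilin (rtensor c x) u u
}.

Section lie_derivative.
Context {R : realType} {n : nat}.

(* zeta(F), read in the chart c *)
Definition vderiv (M : manifold R n) (zeta : vector_field M) (F : M -> R)
    (c : chart M) (x : 'rV[R]_n) : R :=
  'D_(zeta c x) (F \o cinv M c) x.

Definition bracket (X Y : 'rV[R]_n -> 'rV[R]_n) (x : 'rV[R]_n) : 'rV[R]_n :=
  'D_(X x) Y x - 'D_(Y x) X x.

(* (L_zeta k)(X, Y) = zeta(k(X, Y)) - k([zeta, X], Y) - k(X, [zeta, Y]) for
   vector fields X, Y on the domain of the chart c; as L_zeta k is a tensor
   field, such local fields in all charts determine it. *)
Definition lie_derivative (M : manifold R n) (zeta : vector_field M)
    (k : tensor2 M) (c : chart M) (X Y : 'rV[R]_n -> 'rV[R]_n)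
    (x : 'rV[R]_n) : R :=
  'D_(zeta c x) (fun y => bilin (k c y) (X y) (Y y)) x
  - bilin (k c x) (bracket (zeta c) X x) (Y x)
  - bilin (k c x) (X x) (bracket (zeta c) Y x).

Definition conformal (M : manifold R n) (k : tensor2 M)
    (zeta : vector_field M) (rho : M -> R) : Prop :=
  forall (c : chart M) (X Y : 'rV[R]_n -> 'rV[R]_n),
    smooth_on (cimg M c) X -> smooth_on (cimg M c) Y ->
    forall x, cimg M c x ->
      lie_derivative zeta k c X Y x =
      rho (cinv M c x) * bilin (k c x) (X x) (Y x).

Definition killing (M : manifold R n) (k : tensor2 M)
    (zeta : vector_field M) : Prop :=
  forall (c : chart M) (X Y : 'rV[R]_n -> 'rV[R]_n),
    smooth_on (cimg M c) X -> smooth_on (cimg M c) Y ->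
    forall x, cimg M c x -> lie_derivative zeta k c X Y x = 0.

Definition same_field (M : manifold R n) (X Y : vector_field M) : Prop :=
  forall c x, cimg M c x -> X c x = Y c x.

Lemma smooth_zero_field (M : manifold R n) (c : chart M) :
  smooth_on (cimg M c) (fun=> 0 : 'rV[R]_n).
Proof. exact: smooth_cst. Qed.

Definition zero_field (M : manifold R n) : vector_field M.
Proof.
refine (@VectorField _ _ M (fun _ _ => 0) (@smooth_zero_field M) _).
by move=> c d x _; rewrite derive0.
Defined.

End lie_derivative.

Record open_interval (R : realType) := OpenInterval {
  iset :> R -> Prop ;
  iset_open : open (iset : set R) ;
  iset_interval : is_interval iset ;
  iset_nonempty : (iset : set R) !=set0
}.

Arguments iset_open {R} I : rename.
Arguments iset_nonempty {R} I : rename.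

(* Only the values on I are relevant. *)
Record smooth_fun_on (R : realType) (I : open_interval R) := SmoothFunOn {
  ifun :> R -> R ;
  ifun_smooth : smooth_on (iset I) ifun
}.

Section coordinates.
Context {R : realType} {n : nat}.

(* coordinates (t, x) on R * R^n *)
Definition tcoord (x : 'rV[R]_(1 + n)) : R := lsubmx x 0 0.
Definition scoord (x : 'rV[R]_(1 + n)) : 'rV[R]_n := rsubmx x.
Definition tscoord (t : R) (y : 'rV[R]_n) : 'rV[R]_(1 + n) := row_mx t%:M y.

Lemma tcoordK t y : tcoord (tscoord t y) = t.
Proof. by rewrite /tcoord /tscoord row_mxKl mxE eqxx mulr1n. Qed.

Lemma scoordK t y : scoord (tscoord t y) = y.
Proof. by rewrite /scoord /tscoord row_mxKr. Qed.

Lemma tscoordK x : tscoord (tcoord x) (scoord x) = x.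
Proof.
by rewrite /tscoord /tcoord /scoord -mx11_scalar hsubmxK.
Qed.

Lemma tcoord_linear : linear tcoord.
Proof. by move=> a u v; rewrite /tcoord !mxE. Qed.

Lemma scoord_linear : linear scoord.
Proof. by move=> a u v; rewrite /scoord linearP. Qed.

Lemma tcoord_continuous : continuous tcoord.
Proof.
move=> x; apply: (@continuous_comp _ _ _ lsubmx (fun M : 'M[R]_1 => M 0 0)).
  exact: continuous_lsubmx.
exact: coord_continuous.
Qed.

Lemma scoord_continuous : continuous scoord.
Proof. exact: continuous_rsubmx. Qed.

Lemma open_tcoord (U : set R) : open U -> open (tcoord @^-1` U).
Proof. by move=> oU; apply: open_comp oU => y _; exact: tcoord_continuous. Qed.

Lemma open_scoord (U : set 'rV[R]_n) : open U -> open (scoord @^-1` U).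
Proof. by move=> oU; apply: open_comp oU => y _; exact: scoord_continuous. Qed.

Lemma mx_continuousP (T : topologicalType) m p (F : T -> 'M[R]_(m, p)) x :
  (forall i j, {for x, continuous (fun y => F y i j)}) -> {for x, continuous F}.
Proof.
move=> cF; apply/cvgrPdist_le => /= e e0; near=> y.
rewrite /Num.Def.normr/= mx_normrE (bigmax_le _ (ltW e0))//= => i _.
rewrite !mxE; move: i; near: y; apply: filter_forall => /= i.
by have /cvgrPdist_le/(_ _ e0) := cF i.1 i.2.
Unshelve. all: by end_near. Qed.

Definition tincl (t : R) : 'rV[R]_(1 + n) := tscoord t 0.
Definition sincl (y : 'rV[R]_n) : 'rV[R]_(1 + n) := tscoord 0 y.

Lemma tscoordE t y : tscoord t y = tincl t + sincl y.
Proof. by rewrite /tincl /sincl /tscoord add_row_mx add0r raddf0 addr0. Qed.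

Lemma tincl_linear : linear tincl.
Proof.
move=> a u v; rewrite /tincl /tscoord scale_row_mx add_row_mx scaler0 addr0.
by rewrite raddfD/= -scale_scalar_mx.
Qed.

Lemma sincl_linear : linear sincl.
Proof.
move=> a u v; rewrite /sincl /tscoord scale_row_mx add_row_mx.
by rewrite raddf0 scaler0 addr0.
Qed.

Lemma tincl_continuous : continuous tincl.
Proof.
move=> x; apply: mx_continuousP => i j; rewrite (ord1 i).
have -> : (fun t : R => tincl t 0 j) = if fintype.split j is inl _ then id else fun=> 0.
  apply/funext => t; rewrite mxE; case: fintype.split => k; rewrite ?mxE//.
  by rewrite (ord1 k) mulr1n.
by case: fintype.split => _; [exact: cvg_id|exact: cst_continuous].
Qed.

Lemma sincl_continuous : continuous sincl.
Proof.
move=> x; apply: mx_continuousP => i j; rewrite (ord1 i).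
have -> : (fun t => sincl t 0 j) =
    if fintype.split j is inr k then (fun t => t 0 k) else fun=> 0.
  by apply/funext => t; rewrite mxE; case: fintype.split => k; rewrite ?mxE ?mul0rn.
by case: fintype.split => k; [exact: cst_continuous|exact: coord_continuous].
Qed.

Lemma smooth_tscoord (U : set R) (V : set 'rV[R]_n) (a : R -> R)
    (F : 'rV[R]_n -> 'rV[R]_n) : open U -> open V ->
  smooth_on U a -> smooth_on V F ->
  smooth_on [set x | U (tcoord x) /\ V (scoord x)]
    (fun x => tscoord (a (tcoord x)) (F (scoord x))).
Proof.
move=> oU oV sa sF.
have oUt : open (tcoord @^-1` U).
  by exact: open_tcoord oU.
have oVs : open (scoord @^-1` V).
  by exact: open_scoord oV.
have oW : open [set x | U (tcoord x) /\ V (scoord x)] by exact: openI.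
have sa' := smooth_precomp oU tcoord_linear tcoord_continuous sa.
have sF' := smooth_precomp oV scoord_linear scoord_continuous sF.
have sa'' := smooth_postcomp oUt tincl_linear tincl_continuous sa'.
have sF'' := smooth_postcomp oVs sincl_linear sincl_continuous sF'.
apply: smooth_ext (smooth_add oW (smooth_sub _ sa'') (smooth_sub _ sF'')) => //.
- by move=> x _; rewrite tscoordE.
- by move=> x [].
- by move=> x [].
Qed.

Lemma derive_tscoord (a : R -> R) (F : 'rV[R]_n -> 'rV[R]_n) x v :
  derivable a (tcoord x) (tcoord v) -> derivable F (scoord x) (scoord v) ->
  'D_v (fun x => tscoord (a (tcoord x)) (F (scoord x))) x =
  tscoord ('D_(tcoord v) a (tcoord x)) ('D_(scoord v) F (scoord x)).
Proof.
move=> da dF.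
have [da1 ea1] := is_derive_precomp tcoord_linear da.
have [dF1 eF1] := is_derive_precomp scoord_linear dF.
have [da2 ea2] := is_derive_postcomp tincl_linear tincl_continuous da1.
have [dF2 eF2] := is_derive_postcomp sincl_linear sincl_continuous dF1.
have -> : (fun x => tscoord (a (tcoord x)) (F (scoord x))) =
    (tincl \o (a \o tcoord)) \+ (sincl \o (F \o scoord)).
  by apply/funext => y; rewrite tscoordE.
by have [_ ->] := is_derive_add da2 dF2; rewrite ea2 eF2 ea1 eF1 tscoordE.
Qed.

End coordinates.

Section product.
Context {R : realType} {n : nat}.
Variables (I : open_interval R) (M : manifold R n).

Definition idefault : set_type (iset I) :=
  SigSub (mem_set (projT2 (cid (iset_nonempty I)))).

(* junk outside I *)
Definition ipoint (t : R) : set_type (iset I) := insubd idefault t.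

Definition wcdom (c : chart M) : set (set_type (iset I) * M)%type :=
  [set p | cdom M c p.2].

Definition wcimg (c : chart M) : set 'rV[R]_(1 + n) :=
  [set x | I (tcoord x) /\ cimg M c (scoord x)].

Definition wcmap (c : chart M) (p : (set_type (iset I) * M)%type) : 'rV[R]_(1 + n) :=
  tscoord (\val p.1) (cmap M c p.2).

Definition wcinv (c : chart M) (x : 'rV[R]_(1 + n)) : (set_type (iset I) * M)%type :=
  (ipoint (tcoord x), cinv M c (scoord x)).

Lemma ipointK t : I t -> \val (ipoint t) = t.
Proof. by move=> It; rewrite insubdK// inE. Qed.

Lemma valIK (t : set_type (iset I)) : ipoint (\val t) = t.
Proof. exact: valKd. Qed.

Lemma ival (t : set_type (iset I)) : I (\val t).
Proof. by case: t => t It; exact: set_mem. Qed.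

Lemma ipoint_continuous t : I t -> {for t, continuous ipoint}.
Proof.
move=> It A [_ [[V oV <-] Vt] VA].
have {}Vt : V t by rewrite -(ipointK It).
have nI : \near t, I t by exact: open_near (iset_open I) It.
have nV : \near t, V t by exact: open_near oV Vt.
apply: filterS (filterI nI nV) => u [Iu Vu]; apply: VA => /=.
by rewrite -(ipointK Iu) in Vu.
Qed.

Lemma wcdom_open c : open (wcdom c).
Proof.
by apply: (@open_comp _ _ (@snd (set_type (iset I)) M) (cdom M c));
  [move=> p _; exact: cvg_snd|exact: cdom_open].
Qed.

Lemma wcimg_open c : open (wcimg c).
Proof.
apply: openI.
- by exact: open_tcoord (iset_open I).
- by exact: open_scoord (cimg_open c).
Qed.

Lemma wcmap_img c p : wcdom c p -> wcimg c (wcmap c p).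
Proof.
case: p => t p cp; rewrite /wcimg /wcmap /= tcoordK scoordK.
by split; [exact: ival|exact: cmap_img].
Qed.

Lemma wcinv_dom c x : wcimg c x -> wcdom c (wcinv c x).
Proof. by move=> [_]; exact: cinv_dom. Qed.

Lemma wcmapK c p : wcdom c p -> wcinv c (wcmap c p) = p.
Proof.
by case: p => t p cp; rewrite /wcinv /wcmap /= tcoordK scoordK valIK cmapK.
Qed.

Lemma wcinvK c x : wcimg c x -> wcmap c (wcinv c x) = x.
Proof.
by move=> [It cx]; rewrite /wcmap /= ipointK// cinvK// tscoordK.
Qed.

Lemma wcmap_continuous c p : wcdom c p -> {for p, continuous (wcmap c)}.
Proof.
case: p => t p cp.
have -> : wcmap c = (fun q => tincl (\val q.1) + sincl (cmap M c q.2)).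
  by apply/funext => q; rewrite /wcmap tscoordE.
apply: (@continuousD _ _ _ (fun q : set_type (iset I) * M => tincl (\val q.1))
  (fun q : set_type (iset I) * M => sincl (cmap M c q.2))).
  apply: (@continuous_comp _ _ _ (fun q : set_type (iset I) * M => \val q.1) tincl).
    apply: (@continuous_comp _ _ _ fst (set_val : set_type (iset I) -> R)).
      exact: cvg_fst.
    exact: (@initial_continuous (set_type (iset I)) R set_val).
  exact: tincl_continuous.
apply: (@continuous_comp _ _ _ (fun q : set_type (iset I) * M => cmap M c q.2) sincl).
  apply: (@continuous_comp _ _ _ (@snd (set_type (iset I)) M) (cmap M c)).
    exact: cvg_snd.
  exact: cmap_continuous.
exact: sincl_continuous.
Qed.

Lemma wcinv_continuous c x : wcimg c x -> {for x, continuous (wcinv c)}.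
Proof.
move=> [It cx] A [[P Q] /= [nP nQ] PQA].
have n1 : nbhs x [set y | P (ipoint (tcoord y))].
  exact: tcoord_continuous (ipoint_continuous It nP).
have n2 : nbhs x [set y | Q (cinv M c (scoord y))].
  exact: scoord_continuous (cinv_continuous cx nQ).
change (nbhs x (wcinv c @^-1` A)).
by apply: filterS (filterI n1 n2) => y [Py Qy]; apply: PQA; split.
Qed.

Lemma wchart_cover p : exists c, wcdom c p.
Proof. by case: p => t p; have [c cp] := chart_cover p; exists c. Qed.

Lemma overlap_open (c d : chart M) : open (overlap c d).
Proof.
rewrite openE => x [cx dx].
have n1 : \near x, cimg M c x by exact: open_near (cimg_open c) cx.
have n2 := cinv_continuous cx (open_near (cdom_open d) dx).
exact: filterI n1 n2.
Qed.

Lemma smooth_id (V : normedModType R) (U : set V) : smooth_on U (fun x : V => x).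
Proof.
case=> [|k]; (split; first by move=> x _; exact: cvg_id) => // v.
split=> [x _|]; first exact: derivable_id.
have -> : 'D_v (fun x : V => x) = fun=> v.
  by apply/funext => x; exact: derive_id.
exact: smooth_cst.
Qed.

Lemma wtransition_smooth c d :
  smooth_on [set x | wcimg c x /\ wcdom d (wcinv c x)] (wcmap d \o wcinv c).
Proof.
have oo := @overlap_open c d.
have := smooth_tscoord (iset_open I) oo (@smooth_id R (iset I)) (transition_smooth c d).
have -> : [set x | wcimg c x /\ wcdom d (wcinv c x)] =
  [set x | I (tcoord x) /\ overlap c d (scoord x)].
  apply/seteqP; split=> x.
    by move=> [[? ?] ?]; split.
  by move=> [? [? ?]]; split.
apply: smooth_ext.
  apply: openI.
    by exact: open_tcoord (iset_open I).
  by exact: open_scoord oo.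
by move=> x [It _]; rewrite /wcmap /= ipointK.
Qed.

Definition interval_prod : manifold R (1 + n) :=
  @Manifold R (1 + n) (set_type (iset I) * M)%type
    (hausdorff_prod (hausdorff_set_type (@Rhausdorff R)) (@m_hausdorff _ _ M))
    (second_countable_prod (second_countable_set_type _ (@second_countable_real R))
       (@m_second_countable _ _ M))
    (chart M) wcdom wcimg wcmap wcinv wcdom_open wcimg_open wcmap_img wcinv_dom
    wcmapK wcinvK wcmap_continuous wcinv_continuous wchart_cover
    wtransition_smooth.

Section field.
Variables (h : smooth_fun_on I) (zeta : vector_field M).

Definition wfield_comp (c : chart interval_prod) (x : 'rV[R]_(1 + n)) :=
  tscoord (h (tcoord x)) (zeta c (scoord x)).

Lemma wfield_smooth c : smooth_on (cimg interval_prod c) (wfield_comp c).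
Proof.
exact: (smooth_tscoord (iset_open I) (@cimg_open _ _ M c) (ifun_smooth h)
  (vcomp_smooth zeta c)).
Qed.

Lemma derive_wtransition (c d : chart M) x v :
  I (tcoord x) -> overlap c d (scoord x) ->
  'D_v (@transition R _ interval_prod c d) x =
  tscoord (tcoord v) ('D_(scoord v) (transition c d) (scoord x)).
Proof.
move=> It ox.
have e : \near x, tscoord (id (tcoord x)) (transition c d (scoord x)) =
    @transition R _ interval_prod c d x.
  have nI : \near x, I (tcoord x).
    exact: tcoord_continuous (open_near (iset_open I) It).
  by apply: filterS nI => y Iy; rewrite /transition /= /wcmap /= ipointK.
have /(_ 1 )[_ /(_ (scoord v))[dt _]] := transition_smooth c d.
have := @derive_tscoord R n id (transition c d) x v (@derivable_id _ _ _ _) (dt _ ox).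
by rewrite derive_id => <-; rewrite -(near_eq_derive v e).
Qed.

Lemma wfield_change (c d : chart interval_prod) x :
  overlap c d x -> wfield_comp d (transition c d x) =
    'D_(wfield_comp c x) (transition c d) x.
Proof.
move=> [[It cx] dx]; rewrite derive_wtransition//.
rewrite /wfield_comp /= !scoordK !tcoordK ipointK//.
by congr tscoord; rewrite -vcomp_change.
Qed.

(* the vector field h d/dt + zeta on I x M *)
Definition time_space_field : vector_field interval_prod :=
  @VectorField _ _ interval_prod wfield_comp wfield_smooth wfield_change.

End field.
End product.

Section doubly_warped.
Context {R : realType} {n : nat} (I : open_interval R) (M : manifold R n).
Variables (f : smooth_fun M) (sigma : smooth_fun_on I) (g : tensor2 M).

(* - f^2 dt^2 + sigma^2 g *)
Definition warped_comp (c : chart (interval_prod I M)) (x : 'rV[R]_(1 + n)) :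
    'M[R]_(1 + n) :=
  block_mx (- f (cinv M c (scoord x)) ^+ 2)%:M 0
           0 (sigma (tcoord x) ^+ 2 *: g c (scoord x)).

Definition tblock (a : R) : 'M[R]_(1 + n) := block_mx a%:M 0 0 0.
Definition sblock (K : 'M[R]_n) : 'M[R]_(1 + n) := block_mx 0 0 0 K.

Lemma sblock_linear : linear sblock.
Proof.
by move=> a u v; rewrite /sblock scale_block_mx add_block_mx !scaler0 !addr0.
Qed.

Lemma sblock_continuous : continuous sblock.
Proof.
move=> x; apply: mx_continuousP => i j.
have -> : (fun K : 'M[R]_n => sblock K i j) =
    if fintype.split i is inr k then if fintype.split j is inr l then (fun K : 'M[R]_n => K k l)
    else fun=> 0 else fun=> 0.
  by apply/funext => K; rewrite /sblock !mxE; case: fintype.split => k; rewrite mxE;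
    case: fintype.split => l; rewrite ?mxE.
by case: fintype.split => k; [|case: fintype.split => l]; [exact: cst_continuous|exact: cst_continuous|
  exact: coord_continuous].
Qed.

Lemma warped_smooth (c : chart M) : smooth_on (cimg (interval_prod I M) c)
  (warped_comp c).
Proof.
have oU := @wcimg_open R n I M c.
have oUt : open (@tcoord R n @^-1` iset I).
  by exact: open_tcoord (iset_open I).
have oVs : open (@scoord R n @^-1` (cimg M c)).
  by exact: open_scoord (@cimg_open _ _ M c).
have sub1 : wcimg I c `<=` @tcoord R n @^-1` iset I by move=> x [].
have sub2 : wcimg I c `<=` @scoord R n @^-1` (cimg M c) by move=> x [].
have sf := smooth_sub sub2 (smooth_precomp (@cimg_open _ _ M c) scoord_linear
  scoord_continuous (sfun_smooth f c)).
have ss := smooth_sub sub1 (smooth_precomp (iset_open I) tcoord_linear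
  tcoord_continuous (ifun_smooth sigma)).
have sg := smooth_sub sub2 (smooth_postcomp oVs sblock_linear sblock_continuous
  (smooth_precomp (@cimg_open _ _ M c) scoord_linear scoord_continuous
    (tcomp_smooth g c))).
have s1 := smooth_scale oU sf (smooth_scale oU sf
  (@smooth_cst R _ _ (wcimg I c) (tblock (- 1)))).
have s2 := smooth_scale oU ss (smooth_scale oU ss sg).
apply: smooth_ext (smooth_add oU s1 s2) => // x _ /=.
rewrite /warped_comp /tblock /sblock !scale_block_mx add_block_mx.
rewrite !scaler0 !addr0 !add0r !scalerA -!expr2; congr block_mx.
by rewrite scale_scalar_mx mulrN1.
Qed.

Lemma bilin_warped c x u v : bilin (warped_comp c x) u v =
  - f (cinv M c (scoord x)) ^+ 2 * (tcoord u * tcoord v) +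
  sigma (tcoord x) ^+ 2 * bilin (g c (scoord x)) (scoord u) (scoord v).
Proof.
rewrite /bilin /warped_comp.
rewrite -{1}(tscoordK u) -{1}(tscoordK v) /tscoord.
rewrite mul_row_block tr_row_mx mul_row_col !mulmx0 addr0 add0r.
rewrite -scalar_mxM tr_scalar_mx -scalar_mxM mxE [X in X + _ = _]mxE eqxx mulr1n.
rewrite -scalemxAr -scalemxAl [X in _ + X = _]mxE; congr (_ + _).
by rewrite mulrA [tcoord u * _]mulrC.
Qed.

Lemma warped_change (c d : chart (interval_prod I M)) x u v : overlap c d x ->
  bilin (warped_comp c x) u v =
  bilin (warped_comp d (transition c d x))
    ('D_u (transition c d) x) ('D_v (transition c d) x).
Proof.
move=> [[It cx] dx]; rewrite !derive_wtransition// !bilin_warped.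
rewrite /= !scoordK !tcoordK ipointK// cmapK//.
by congr (_ + _ * _); exact: tcomp_change.
Qed.

Definition doubly_warped : tensor2 (interval_prod I M) :=
  @Tensor2 _ _ (interval_prod I M) warped_comp warped_smooth warped_change.

End doubly_warped.

(* zeta-bar = h d/dt + zeta is time-like if it equals h d/dt, and space-like if
   it equals zeta. *)
Section causal.
Context {R : realType} {n : nat} (I : open_interval R) (M : manifold R n).

Definition zero_fun_on : smooth_fun_on I :=
  SmoothFunOn (@smooth_cst R R R (iset I) 0).

Definition timelike (h : smooth_fun_on I) (zeta : vector_field M) : Prop :=
  same_field (time_space_field h zeta) (time_space_field h (zero_field M)).

Definition spacelike (h : smooth_fun_on I) (zeta : vector_field M) : Prop :=
  same_field (time_space_field h zeta) (time_space_field zero_fun_on zeta).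

End causal.

(* Main.v *)
Require Import Defs.
From HB Require Import structures.
From mathcomp Require Import all_boot all_order all_algebra.
From mathcomp Require Import all_classical all_reals all_analysis.
From mathcomp Require Import ring.
Set Implicit Arguments.
Unset Strict Implicit.
Unset Printing Implicit Defensive.
Import Order.TTheory GRing.Theory Num.Theory.
Import numFieldNormedType.Exports.
Local Open Scope classical_set_scope.
Local Open Scope ring_scope.

(* Since h depends only on t and zeta only on M, the Lie derivative of
   - f^2 dt^2 + sigma^2 g along h d/dt + zeta has no mixed terms: it is
   - 2 f^2 (h' + zeta(ln f)) dt^2
     + sigma^2 (L_zeta g + (2 h sigma' / sigma) g).
   Its vanishing is therefore condition (3), of which (1) and (2) are special
   cases. *)

(** * Directional derivatives of compositions and bilinear expressions *)

Section directional_derivatives.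
Context {R : realType}.
Implicit Types V W : normedModType R.

Lemma smooth_derivable V W (U : set V) (F : V -> W) x v :
  smooth_on U F -> U x -> derivable F x v.
Proof. by move=> /(_ 1)[_ /(_ v)[dF _]] Ux; exact: dF. Qed.

(** A derivative along [v] only sees the line r -> r v + x, so the one-variable chain rule applies
    to [F] restricted to it. *)
Lemma is_derive_comp_real V (phi : R -> R) (F : V -> R) x v a :
  is_derive (F x) 1 phi a -> derivable F x v ->
  is_derive x v (phi \o F) (a * 'D_v F x).
Proof.
move=> dphi dF.
have lineE (G : V -> R) : (fun s : R => s^-1 *: ((G \o shift x) (s *: v) - G x))
    = (fun s : R => s^-1 *: (((fun r : R => G (r *: v + x)) \o shift 0)
         (s *: (1 : R)) - G (0 *: v + x))).
  by apply/funext => s /=; rewrite scale0r add0r addr0 [_ *: 1]mulr1.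
have dline : is_derive (0 : R) 1 (fun r : R => F (r *: v + x)) ('D_v F x).
  by split; [exact: (derivable1P F x v).1 dF | rewrite /derive (lineE F)].
have dphi' : is_derive (F (0 *: v + x)) 1 phi a by rewrite scale0r add0r.
have [dc ?] := is_derive1_comp (g := fun r : R => F (r *: v + x)) dphi' dline.
split; first exact: (derivable1P (phi \o F) x v).2 dc.
by rewrite /derive (lineE (phi \o F)).
Qed.

Lemma derive_real_dir (F : R -> R) t v :
  derivable F t 1 -> 'D_v F t = v * derive1 F t.
Proof.
move=> /derivable1_diffP dF; rewrite derive1E !deriveE//.
by rewrite -{1}[v]mulr1 -[v * 1]/(v *: 1) linearZ.
Qed.

(** Leibniz's rule for a product of three factors, applied to each entry of the double sum that
    expands the form. *)
Lemma is_derive_bilin V m (A : V -> 'M[R]_m) (X Y : V -> 'rV[R]_m) x v :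
  derivable A x v -> derivable X x v -> derivable Y x v ->
  is_derive x v (fun y => bilin (A y) (X y) (Y y))
    (bilin ('D_v A x) (X x) (Y x) + bilin (A x) ('D_v X x) (Y x)
     + bilin (A x) (X x) ('D_v Y x)).
Proof.
have bilinE (B : 'M[R]_m) (u w : 'rV[R]_m) :
    bilin B u w = \sum_j \sum_i u 0 i * B i j * w 0 j.
  rewrite /bilin mxE; apply: eq_bigr => j _; rewrite !mxE mulr_suml.
  by apply: eq_bigr.
move=> dA dX dY; rewrite !derive_mx//.
have /derivable_mxP eA := dA; have /derivable_mxP eX := dX.
have /derivable_mxP eY := dY.
have -> : (fun y => bilin (A y) (X y) (Y y)) = \sum_(j < m) \sum_(i < m)
    ((fun y => X y 0 i) * (fun y => A y i j) * (fun y => Y y 0 j)).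
  apply/funext => y; rewrite bilinE fct_sumE; apply: eq_bigr => j _.
  by rewrite fct_sumE.
rewrite !bilinE -!big_split/=.
apply: is_derive_sum => j; rewrite -!big_split/=.
apply: is_derive_sum => i; rewrite !mxE.
have [dXi dAij dYj] := And3 (eX 0 i) (eA i j) (eY 0 j).
apply: is_derive_eq.
  apply: is_deriveM; last exact: derivableP dYj.
  by apply: is_deriveM; exact: derivableP.
by rewrite mulrfctE /GRing.scale/=; ring.
Qed.

End directional_derivatives.

Arguments smooth_derivable {R V W U F x} v _ _.

(** * The Lie derivative as a pointwise bilinear form *)

Section lie_form.
Context {R : realType} {m : nat}.

(* Leibniz's rule turns the brackets of [lie_derivative] into derivatives of
   zeta; this is the resulting expression, visibly depending only on the values
   of the two fields at the point. *)
Definition lie_form (M : manifold R m) (zeta : vector_field M)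
    (k : tensor2 M) (c : chart M) (x u v : 'rV[R]_m) : R :=
  bilin ('D_(zeta c x) (k c) x) u v + bilin (k c x) ('D_u (zeta c) x) v
  + bilin (k c x) u ('D_v (zeta c) x).

Lemma bilinBl (A : 'M[R]_m) u u' v :
  bilin A (u - u') v = bilin A u v - bilin A u' v.
Proof. by rewrite /bilin !mulmxBl !mxE. Qed.

Lemma bilinBr (A : 'M[R]_m) u v v' :
  bilin A u (v - v') = bilin A u v - bilin A u v'.
Proof. by rewrite /bilin linearB mulmxBr !mxE. Qed.

Lemma bilin0l (A : 'M[R]_m) v : bilin A 0 v = 0.
Proof. by rewrite /bilin !mul0mx mxE. Qed.

Lemma bilin0r (A : 'M[R]_m) u : bilin A u 0 = 0.
Proof. by rewrite /bilin trmx0 mulmx0 mxE. Qed.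

(** The derivatives of [X] and [Y] along zeta given by Leibniz's rule cancel against those in the
    two brackets. *)
Lemma lie_derivativeE (M : manifold R m) (zeta : vector_field M)
    (k : tensor2 M) (c : chart M) X Y x :
  smooth_on (cimg M c) X -> smooth_on (cimg M c) Y -> cimg M c x ->
  lie_derivative zeta k c X Y x = lie_form zeta k c x (X x) (Y x).
Proof.
move=> sX sY cx.
have dX := smooth_derivable (zeta c x) sX cx.
have dY := smooth_derivable (zeta c x) sY cx.
have dk := smooth_derivable (zeta c x) (tcomp_smooth k c) cx.
rewrite /lie_derivative /lie_form.
rewrite (derive_val (is_derive := is_derive_bilin dk dX dY)).
by rewrite /bracket bilinBl bilinBr; ring.
Qed.

Lemma conformalP (M : manifold R m) (k : tensor2 M) (zeta : vector_field M)
    (rho : M -> R) :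
  conformal k zeta rho <-> forall c x u v, cimg M c x ->
    lie_form zeta k c x u v = rho (cinv M c x) * bilin (k c x) u v.
Proof.
split=> [Z c x u v cx|Z c X Y sX sY x cx].
  (* Constant fields extend arbitrary vectors [u], [v] at the point. *)
  have su w : smooth_on (cimg M c) (fun=> w : 'rV[R]_m) by exact: smooth_cst.
  by rewrite -(Z c _ _ (su u) (su v) x cx) lie_derivativeE.
by rewrite lie_derivativeE// Z.
Qed.

Lemma killing_conformal (M : manifold R m) (k : tensor2 M)
    (zeta : vector_field M) : killing k zeta <-> conformal k zeta (fun=> 0).
Proof.
by split=> Z c X Y sX sY x cx; rewrite (Z c X Y sX sY x cx) mul0r.
Qed.

Lemma killingP (M : manifold R m) (k : tensor2 M) (zeta : vector_field M) :
  killing k zeta <-> forall c x u v, cimg M c x -> lie_form zeta k c x u v = 0.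
Proof.
rewrite killing_conformal conformalP.
by split=> Z c x u v cx; rewrite Z// mul0r.
Qed.

End lie_form.

(** * The Lie derivative of the doubly warped metric *)

Section warped.
Context {R : realType} {n : nat} (M : manifold R n) (I : open_interval R).
Variables (g : tensor2 M) (f : smooth_fun M) (sigma h : smooth_fun_on I).
Variable zeta : vector_field M.
Hypothesis f_gt0 : forall p : M, 0 < f p.
Hypothesis sigma_gt0 : forall t : R, I t -> 0 < sigma t.

Lemma vderiv_ln (c : chart M) x : cimg M c x ->
  vderiv zeta (fun p => ln (f p)) c x = vderiv zeta f c x / f (cinv M c x).
Proof.
move=> cx; have df := smooth_derivable (zeta c x) (sfun_smooth f c) cx.
have dln := is_derive1_ln (f_gt0 (cinv M c x)).
rewrite /vderiv mulrC.
by rewrite -(derive_val (is_derive := is_derive_comp_real dln df)).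
Qed.

Lemma derive_warped (c : chart M) x u v w : I (tcoord x) ->
  cimg M c (scoord x) ->
  bilin ('D_w (doubly_warped f sigma g c) x) u v =
  - (2 * f (cinv M c (scoord x)) * 'D_(scoord w) (f \o cinv M c) (scoord x))
      * (tcoord u * tcoord v)
  + 2 * sigma (tcoord x) * (tcoord w * derive1 sigma (tcoord x))
      * bilin (g c (scoord x)) (scoord u) (scoord v)
  + sigma (tcoord x) ^+ 2
      * bilin ('D_(scoord w) (g c) (scoord x)) (scoord u) (scoord v).
Proof.
move=> It cx.
have wx : wcimg I c x by split.
have dk := smooth_derivable w (tcomp_smooth (doubly_warped f sigma g) c) wx.
have dcst (V W : normedModType R) (a : W) (y z : V) :=
  @derivable_cst R V W a y z.
(* With [u] and [v] held constant, the derivative of the matrix field is read off from that of a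
   scalar function. *)
have [_] := is_derive_bilin dk (dcst _ _ u _ _) (dcst _ _ v _ _).
rewrite !derive_cst bilin0l bilin0r !addr0 => <-.
have dsig := smooth_derivable (tcoord w) (ifun_smooth sigma) It.
have dsig1 := smooth_derivable (1 : R) (ifun_smooth sigma) It.
have df := smooth_derivable (scoord w) (sfun_smooth f c) cx.
have dg := smooth_derivable (scoord w) (tcomp_smooth g c) cx.
have hsig := is_derive_precomp tcoord_linear dsig.
have hf := is_derive_precomp scoord_linear df.
have [dgb egb] :=
  is_derive_bilin dg (dcst _ _ (scoord u) _ _) (dcst _ _ (scoord v) _ _).
have hg := is_derive_precomp scoord_linear dgb.
rewrite egb !derive_cst bilin0l bilin0r !addr0 in hg.
(* Each factor now depends on time alone or on space alone, and the product and power rules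
   apply. *)
have -> : (fun y => bilin (doubly_warped f sigma g c y) u v) =
    cst (- (tcoord u * tcoord v)) * ((f \o cinv M c \o scoord) ^+ 2)
    + (sigma \o tcoord) ^+ 2
      * ((fun y => bilin (g c y) (scoord u) (scoord v)) \o scoord).
  apply/funext => y /=; rewrite bilin_warped.
  by rewrite addrfctE !mulrfctE !exprfctE /=; ring.
have [_ ->] := is_deriveD
  (is_deriveM (is_derive_cst (- (tcoord u * tcoord v)) x w) (is_deriveX 2 hf))
  (is_deriveM (is_deriveX 2 hsig) hg).
rewrite (derive_real_dir _ dsig1) /GRing.scale/=.
by rewrite !exprfctE /=; ring.
Qed.

(** Differentiating f^2 gives the zeta(ln f) term and differentiating sigma^2 the sigma' term;
    differentiating the field gives h' and completes the Lie form of [g]. *)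
Lemma lie_form_warped (c : chart M) x u v : I (tcoord x) ->
  cimg M c (scoord x) ->
  lie_form (time_space_field h zeta) (doubly_warped f sigma g) c x u v =
  - 2 * f (cinv M c (scoord x)) ^+ 2
      * (derive1 h (tcoord x) + vderiv zeta (fun p => ln (f p)) c (scoord x))
      * (tcoord u * tcoord v)
  + sigma (tcoord x) ^+ 2
      * (2 * h (tcoord x) * derive1 sigma (tcoord x) / sigma (tcoord x)
           * bilin (g c (scoord x)) (scoord u) (scoord v)
         + lie_form zeta g c (scoord x) (scoord u) (scoord v)).
Proof.
move=> It cx; rewrite vderiv_ln// /lie_form derive_warped//.
(* The differential of the field is block diagonal, which is why no mixed terms arise. *)
have dw w : 'D_w (time_space_field h zeta c) x =
    tscoord (tcoord w * derive1 h (tcoord x))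
      ('D_(scoord w) (zeta c) (scoord x)).
  have dh v := smooth_derivable v (ifun_smooth h) It.
  rewrite -(derive_real_dir _ (dh 1)) -derive_tscoord//.
  exact: smooth_derivable (vcomp_smooth zeta c) cx.
rewrite !dw !bilin_warped !tcoordK !scoordK /=.
rewrite /vderiv; field.
by rewrite !lt0r_neq0// sigma_gt0.
Qed.

(** Pure time vectors isolate the first summand of [lie_form_warped] and pure space vectors the
    second; the factors f^2 and sigma^2 can be divided out because they are positive. *)
Lemma killing_warpedP :
  killing (doubly_warped f sigma g) (time_space_field h zeta) <->
  (forall t : R, I t -> forall (c : chart M) x, cimg M c x ->
     derive1 h t = - vderiv zeta (fun p => ln (f p)) c x) /\
  (forall t : R, I t ->
     conformal g zeta (fun=> - (2 * h t * derive1 sigma t / sigma t))).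
Proof.
rewrite killingP; split=> [K|[hf gz] c x u v [It cx]].
  split=> t It => [c x cx|].
    have wx : wcimg I c (tscoord t x) by rewrite /wcimg /= tcoordK scoordK.
    have := K c (tscoord t x) (tscoord 1 0) (tscoord 1 0) wx.
    rewrite lie_form_warped ?tcoordK ?scoordK//.
    rewrite /lie_form !bilin0l !bilin0r !addr0 !mulr0 addr0 !mulr1.
    move=> /eqP; rewrite !mulf_eq0 oppr_eq0 pnatr_eq0 !(gt_eqF (f_gt0 _))/=.
    by rewrite addr_eq0 => /eqP.
  apply/conformalP => c x u v cx.
  have wx : wcimg I c (tscoord t x) by rewrite /wcimg /= tcoordK scoordK.
  have := K c (tscoord t x) (tscoord 0 u) (tscoord 0 v) wx.
  rewrite lie_form_warped ?tcoordK ?scoordK// !mulr0 add0r.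
  move=> /eqP; rewrite mulf_eq0 expf_eq0 gt_eqF ?sigma_gt0//=.
  by rewrite addrC addr_eq0 mulNr => /eqP.
rewrite lie_form_warped// (hf _ It _ _ cx) addNr mulr0 mul0r add0r.
by have /conformalP-> := gz _ It; rewrite // mulNr subrr mulr0.
Qed.

End warped.

(** * Comparison of the three conditions *)

Theorem theorem9 (R : realType) (n : nat) (M : manifold R n)
    (g : riemannian_metric M) (I : open_interval R)
    (f : smooth_fun M) (sigma : smooth_fun_on I)
    (h : smooth_fun_on I) (zeta : vector_field M)
    (f_gt0 : forall p : M, 0 < f p)
    (sigma_gt0 : forall t : R, I t -> 0 < sigma t) :
  killing (doubly_warped f sigma g) (time_space_field h zeta) <->
  [\/ timelike h zeta /\
        (forall t : R, I t -> derive1 h t = 0 /\ derive1 sigma t = 0),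
      [/\ spacelike h zeta,
          killing g zeta &
          forall (c : chart M) (x : 'rV[R]_n), cimg M c x ->
            vderiv zeta f c x = 0] |
      (forall t : R, I t -> forall (c : chart M) (x : 'rV[R]_n), cimg M c x ->
         derive1 h t = - vderiv zeta (fun p => ln (f p)) c x) /\
      (forall t : R, I t ->
         conformal g zeta (fun=> - (2 * h t * derive1 sigma t / sigma t)))].
Proof.
(* The Killing equation has become condition (3), so it remains to deduce (3) from (1) and from
   (2). *)
rewrite killing_warpedP//; split=> [?|]; first by apply: Or33.
case=> [[tl hs]|[sl kz fz]|//].
  (* Being time-like is an equality of fields on I x M; its space component at (t, x) gives zeta = 0
     at x. *)
  have z0 c x t : I t -> cimg M c x -> zeta c x = 0.
    move=> It cx; have wx : wcimg I c (tscoord t x).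
      by rewrite /wcimg /= tcoordK scoordK.
    have := tl c _ wx; rewrite /= /wfield_comp scoordK => /(congr1 scoord).
    by rewrite !scoordK.
  split=> t It => [c x cx|].
    by rewrite /vderiv (z0 c x t)// derive0 oppr0; have [] := hs t It.
  apply/conformalP => c x u v cx; have [_ ->] := hs t It.
  have dz w : 'D_w (zeta c) x = 0.
    (* Components are known to vanish only on the chart image; it is open, so the derivative at [x]
       vanishes too. *)
    rewrite -(derive_cst (0 : 'rV[R]_n) x w); apply: near_eq_derive.
    by apply: filterS (open_near (cimg_open c) cx) => y cy; rewrite (z0 c y t).
  rewrite /lie_form !dz (z0 c x t)// derive0 bilin0l bilin0r !addr0.
  by rewrite !(mulr0, mul0r) oppr0 mul0r /bilin mulmx0 mul0mx mxE.
(* Here the time components are compared, at a point (t, x) of a product chart; hence the chart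
   point [x] in the premises. *)
have h0 c x t : I t -> cimg M c x -> h t = 0.
  move=> It cx; have wx : wcimg I c (tscoord t x).
    by rewrite /wcimg /= tcoordK scoordK.
  have := sl c _ wx; rewrite /= /wfield_comp tcoordK => /(congr1 tcoord).
  by rewrite !tcoordK.
split=> t It => [c x cx|].
  (* Both sides are zero: zeta(ln f) = zeta(f)/f, and [h] vanishes on the open set [I]. *)
  rewrite vderiv_ln// fz// mul0r oppr0 derive1E -(derive_cst (0 : R) t 1).
  apply: near_eq_derive.
  by apply: filterS (open_near (iset_open I) It) => s Is; rewrite (h0 c x s).
apply/conformalP => c x u v cx; have /killingP-> // := kz.
by rewrite (h0 c x t)// !(mulr0, mul0r) oppr0 mul0r.
Qed.
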